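(* There exists a $(14176,8,1)$-RBIBD.
   Context: A $(v,k,\lambda)$-BIBD is a pair $(V,\mathcal{A})$ where $V$ is a set of $v$ points and $\mathcal{A}$ is a collection of $k$-subsets of $V$ (blocks) such that every $2$-subset of $V$ is contained in exactly $\lambda$ blocks of $\mathcal{A}$. It is resolvable (a $(v,k,\lambda)$-RBIBD) if there exists a partition of $\mathcal{A}$ (a resolution) into parallel classes, each of which is a partition of $V$. *)

(* Defs.v *)
From mathcomp Require Import all_boot.

Set Implicit Arguments.
Unset Strict Implicit.
Unset Printing Implicit Defensive.

(* A collection of blocks is a sequence considered up to [perm_eq], that is,
   a multiset: when lambda > 1 blocks may be repeated. *)
Definition is_bibd (V : finType) (v k lambda : nat) (A : seq {set V}) : Prop :=
  [/\ #|V| = v,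
      forall B : {set V}, B \in A -> #|B| = k
    & forall S : {set V}, #|S| = 2 ->
        count (fun B : {set V} => S \subset B) A = lambda].

Definition parallel_class (V : finType) (P : seq {set V}) : Prop :=
  uniq P /\ partition [set B in P] [set: V].

Definition resolution (V : finType) (A : seq {set V})
    (R : seq (seq {set V})) : Prop :=
  perm_eq (flatten R) A /\
  forall P : seq {set V}, P \in R -> parallel_class P.

Definition is_rbibd (V : finType) (v k lambda : nat) (A : seq {set V}) : Prop :=
  is_bibd v k lambda A /\ exists R : seq (seq {set V}), resolution A R.

(* Main.v *)
Require Import Defs.
From mathcomp Require Import all_boot.
From HB Require Import structures.
From mathcomp Require Import all_algebra all_field.

Set Implicit Arguments.
Unset Strict Implicit.
Unset Printing Implicit Defensive.

Import GRing.Theory.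

(** The points of the design are the elements of an abelian group of order
    [14175 = 7 * 9 * 9 * 25] and one point at infinity.  It is built by
    climbing through resolvable designs on 8, 64, 568 and 14176 points, each
    step using the same construction [frame_df_fill].

    A frame difference family over [A * K], relative to the hole [A], consists
    of base blocks whose differences cover each element outside [A * 0] exactly
    once, grouped into families such that the [K]-coordinates of each family
    run exactly once through the nonzero elements of [K].  All translates of
    the base blocks then cover each pair of points with distinct
    [K]-coordinates once.  The [A]-translates of one family, shifted by [k] in
    [K], partition the complement of the coset [A * k]; adding a parallel class
    of a resolvable design on that coset and infinity completes them to a
    parallel class of the whole.

    - From 8 to 64: in the affine plane of order 8, the nonzero points form the
      multiplicative group of the field of order 64, isomorphic to
      [Z_7 * Z_9]; one line avoiding 0 is a frame difference family with hole
      [Z_7].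
    - A frame difference family can be inflated by a finite field [F]
      ([frame_df_inflate]): hole and number of families are both multiplied by
      [#|F|].  Inflating the previous one by the field of order 9 leads from 64
      to [7 * 9 * 9 + 1 = 568].
    - From 568 to 14176: 27 base blocks over [(Z_7 * Z_3^2) * Z_5^2], obtained
      from two of them by a group of 24 automorphisms, form a frame difference
      family ([frame_block_frame_df]); inflated by the field of order 9 it has
      a hole of order [7 * 9 * 9 = 567] and 81 families, which matches the
      resolvable design on 568 points.

    The two explicit families are checked by computing that their differences
    are distinct, and that so are the [K]-coordinates within each family
    ([frame_df_check]); a count then shows that they cover all that they
    should. *)

(* Gives products of finite abelian groups their finite group structure. *)
HB.saturate prod.

(** * Resolvable designs presented by labels *)

(** A resolvable design with index 1 and block size [k] on the points [V], with
    parallel classes indexed by [C]: [e c x] is the label of the block of class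
    [c] containing [x], so that blocks are the nonempty fibres of the [e c],
    and two distinct points have the same label in exactly one class. *)
Definition resolvable_design (k : nat) (V C : finType) : Prop :=
  exists (L : finType) (e : C -> V -> L),
    (forall c x, #|[set y | e c y == e c x]| = k) /\
    (forall x y, x != y -> exists! c, e c x = e c y).

(** The blocks of the class [c] are the parts of [preim_partition (e c)]. *)
Lemma resolvable_design_rbibd k (V C : finType) :
  resolvable_design k V C ->
  exists A : seq {set V}, is_rbibd #|V| k 1 A.
Proof.
move=> [L [e [ek euniq]]].
pose P c := preim_partition (e c) [set: V].
have memP c B : B \in P c -> exists x, B = [set y | e c y == e c x].
  case/imsetP=> x _ ->; exists x; apply/setP => y.
  by rewrite !inE eq_sym.
have fiberP c x : [set y | e c y == e c x] \in P c.
  apply/imsetP; exists x; rewrite ?inE //; apply/setP => y.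
  by rewrite !inE eq_sym.
exists (flatten [seq enum (P c) | c <- enum C]); split; first split => //.
- move=> B /flattenP[s /mapP[c _ ->]]; rewrite mem_enum.
  by case/memP=> x ->; exact: ek.
- move=> S /eqP/cards2P[x [y [nxy ->]]].
  rewrite count_flatten -map_comp sumnE big_map /=.
  have cntE c : count (fun B : {set V} => [set x; y] \subset B) (enum (P c))
                = (e c x == e c y) :> nat.
    have -> : count (fun B : {set V} => [set x; y] \subset B) (enum (P c))
              = count (fun B => (e c x == e c y)
                         && (B == [set z | e c z == e c x])) (enum (P c)).
      apply: eq_in_count => B; rewrite mem_enum => /memP[z ->].
      rewrite subUset !sub1set !inE; apply/andP/andP.
        by move=> [/eqP-> /eqP->].
      move=> [/eqP exy /eqP/setP/(_ x)]; rewrite !inE eqxx => exz.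
      by rewrite -exy exz.
    case: (e c x == e c y) => /=; last by rewrite count_pred0.
    by rewrite (count_uniq_mem _ (enum_uniq _)) mem_enum fiberP.
  under eq_bigr => c _ do rewrite cntE.
  have [c0 [exy c0P]] := euniq x y nxy.
  rewrite big_enum /= (bigD1 c0) //= exy eqxx big1 // => c ncc0.
  by case: eqP => // /c0P cE; rewrite cE eqxx in ncc0.
exists [seq enum (P c) | c <- enum C]; split; first exact: perm_refl.
move=> Q /mapP[c _ ->]; split; first exact: enum_uniq.
have -> : [set B in enum (P c)] = P c by apply/setP => B; rewrite inE mem_enum.
exact: preim_partitionP.
Qed.

Lemma eq_card_bij (S T : finType) :
  #|S| = #|T| -> exists f : S -> T, bijective f.
Proof.
move=> cST; exists (fun x => enum_val (cast_ord cST (enum_rank x))).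
exists (fun y => enum_val (cast_ord (esym cST) (enum_rank y))) => x;
  by rewrite enum_valK ?cast_ordK ?cast_ordKV enum_rankK.
Qed.

Lemma resolvable_design_card k (V C V' C' : finType) :
  #|V'| = #|V| -> #|C'| = #|C| ->
  resolvable_design k V C -> resolvable_design k V' C'.
Proof.
move=> cV cC [L [e [ek euniq]]].
have [f [f' fK f'K]] := eq_card_bij cV.
have [g [g' gK g'K]] := eq_card_bij cC.
exists L, (fun c x => e (g c) (f x)); split=> [c x | x y nxy].
  rewrite -(ek (g c) (f x)) -(card_imset _ (can_inj fK)); congr #|pred_of_set _|.
  apply/setP => y; rewrite inE; apply/imsetP/idP => [[z]|eyx].
    by rewrite inE => eyx ->.
  by exists (f' y); rewrite ?inE f'K.
have [|c [exy cP]] := euniq (f x) (f y); first by rewrite (inj_eq (can_inj fK)).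
exists (g' c); split; first by rewrite g'K.
by move=> c' /cP ->; rewrite gK.
Qed.

(** A single block. *)
Lemma resolvable_design_trivial (V : finType) : resolvable_design #|V| V unit.
Proof.
exists unit, (fun _ _ => tt).
split=> [c x | x y _]; last by exists tt; split=> // -[].
by rewrite -cardsT; congr #|pred_of_set _|; apply/setP => y; rewrite !inE eqxx.
Qed.

Local Open Scope ring_scope.

(** * Frame difference families *)

(** Frame difference family over [A * K] relative to [A]: [b j i t] is the
    [t]-th element of the [i]-th base block of the [j]-th family.  Its first
    three conditions say that the [K]-coordinates of each family run exactly
    once through the nonzero elements of [K], the last two that the differences
    within base blocks run exactly once through the elements outside the
    hole. *)
Record frame_df (A K : zmodType) (J I T : finType)
    (b : J -> I -> T -> A * K) : Prop := FrameDF {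
  fdf_nz : forall j i t, (b j i t).2 != 0;
  fdf_cover : forall j d, d != 0 -> exists i t, (b j i t).2 = d;
  fdf_inj : forall j i t i' t',
    (b j i t).2 = (b j i' t').2 -> i = i' /\ t = t';
  fdf_diff_cover : forall g : A * K, g.2 != 0 ->
    exists j i t s, b j i t - b j i s = g;
  fdf_diff_inj : forall j i t s j' i' t' s', t != s ->
    b j i t - b j i s = b j' i' t' - b j' i' s' ->
    [/\ j = j', i = i', t = t' & s = s'] }.

(** The base blocks are copied once for each [m] in [F], with the additional
    coordinate [m * y t]: as [y t - y s] is invertible for [t != s], each
    difference of the original family comes exactly once with each additional
    coordinate. *)
Lemma frame_df_inflate (A K : zmodType) (J I T : finType)
    (b : J -> I -> T -> A * K) (F : finFieldType) (y : T -> F) :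
  injective y -> frame_df b ->
  frame_df (fun (jm : J * F) i t =>
    (((b jm.1 i t).1, jm.2 * y t), (b jm.1 i t).2) : (A * F) * K).
Proof.
move=> y_inj [nz cover inj dcover dinj]; split => /=.
- by move=> [j m] i t; exact: nz.
- by move=> [j m] d; exact: cover.
- by move=> [j m] i t i' t'; exact: inj.
- move=> [[a f] d] /= dn0.
  have [j [i [t [s Eg]]]] := dcover (a, d) dn0.
  have nts : y t - y s != 0.
    rewrite subr_eq0 (inj_eq y_inj); apply: contraNneq dn0 => ts.
    by move: Eg; rewrite ts subrr => -[_ <-].
  exists (j, f / (y t - y s)), i, t, s => /=.
  move: Eg; case: (b j i t) (b j i s) => [a1 d1] [a2 d2] [<- <-].
  have E : f / (y t - y s) * y t - f / (y t - y s) * y s = f.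
    by rewrite -mulrBr divfK.
  by congr (_, _, _).
- move=> [j m] i t s [j' m'] i' t' s' nts /= E.
  have [] := dinj j i t s j' i' t' s' nts.
    move: E; case: (b j i t) (b j i s) (b j' i' t') (b j' i' s')
      => [? ?] [? ?] [? ?] [? ?] [E1 _ E2].
    exact: (congr2 pair E1 E2).
  move=> jj' ii' tt' ss'; subst j' i' t' s'; split=> //.
  have Em : m * y t - m * y s = m' * y t - m' * y s by case: E.
  congr (_, _); move: Em; rewrite -!mulrBr; apply: mulIf.
  by rewrite subr_eq0 (inj_eq y_inj).
Qed.

Lemma subr_swap (G : zmodType) (x y z w : G) : x - y = z - w -> z - x = w - y.
Proof.
move=> H; have -> : z = x - y + w by rewrite H subrK.
by rewrite addrC -addrA addKr addrC.
Qed.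

(** Filling the holes: the parallel class of index [(k, j)] consists of the
    class [j] of the given design, placed on [A * k] and infinity, and of the
    [A]-translates of the base blocks of the family [j] shifted by [k]. *)
Lemma frame_df_fill (A K : finZmodType) (J I T : finType)
    (b : J -> I -> T -> A * K) :
  frame_df b -> resolvable_design #|T| (option A) J ->
  resolvable_design #|T| (option (A * K)) (K * J)%type.
Proof.
move=> [nz cover inj dcover dinj] [L [e [ek euniq]]].
(* pos j d is the place (i, t) where d occurs as a K-coordinate of the family
   j, or None when d = 0. *)
pose ok j d (q : option (I * T)) :=
  if q is Some it then (b j it.1 it.2).2 == d else d == 0.
have okP j d : exists q, ok j d q.
  have [->|dn0] := eqVneq d 0; first by exists None; rewrite /ok.
  by have [i [t /eqP E]] := cover j d dn0; exists (Some (i, t)).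
pose pos j d := xchoose (okP j d).
have posK j d : ok j d (pos j d) by exact: xchooseP.
have posE j i t : pos j (b j i t).2 = Some (i, t).
  have := posK j (b j i t).2; case: (pos _ _) => [[i' t'] /eqP /= /inj[-> ->] //|].
  by rewrite /ok (negPf (nz j i t)).
have pos0 j : pos j 0 = None.
  by have := posK j 0; case: (pos _ _) => [[i t] /=|//]; rewrite (negPf (nz j i t)).
have posS j d i t : pos j d = Some (i, t) -> (b j i t).2 = d.
  by move=> E; have := posK j d; rewrite E => /eqP.
have posN j d : pos j d = None -> d = 0.
  by move=> E; have := posK j d; rewrite E => /eqP.
(* Blocks in the hole keep their label; the translate by (a, k) of the i-th base
   block of the family j is labelled (i, a) in the class (k, j). *)
pose e' (c : K * J) (x : option (A * K)) : L + (I * A) :=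
  if x is Some (a, k) then
    if pos c.2 (k - c.1) is Some (i, t) then inr (i, a - (b c.2 i t).1)
    else inl (e c.2 (Some a))
  else inl (e c.2 None).
have e'hole k j a : e' (k, j) (Some (a, k)) = inl (e j (Some a)).
  by rewrite /e' /= subrr pos0.
have e'b (k : K) j i t (a : A) :
    e' (k, j) (Some ((b j i t).1 + a, (b j i t).2 + k)) = inr (i, a).
  by rewrite /e' /= addrK posE addrC addKr.
pose emb (k : K) (x : option A) : option (A * K) :=
  if x is Some a then Some (a, k) else None.
have emb_inj k : injective (emb k).
  by move=> [a|] [a'|] //= [->].
have e'emb k j x : e' (k, j) (emb k x) = inl (e j x).
  by case: x => [a|] //; exact: e'hole.
have e'P (k : K) j x : (exists u, x = emb k u) \/
   (exists i t (a : A), x = Some ((b j i t).1 + a, (b j i t).2 + k)).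
  case: x => [[a d]|]; last by left; exists None.
  case E: (pos j (d - k)) => [[i t]|]; [right|left].
    exists i, t, (a - (b j i t).1); rewrite (posS _ _ _ _ E).
    by rewrite subrK addrC subrK.
  by exists (Some a); move/posN/eqP: E; rewrite subr_eq0 => /eqP->.
exists _, e'; split.
- move=> [k j] x; case: (e'P k j x) => [[u ->]|[i [t [a ->]]]].
    rewrite e'emb -(ek j u) -(card_imset _ (@emb_inj k)).
    congr #|pred_of_set _|; apply/setP => y; rewrite inE.
    apply/idP/imsetP => [|[v]]; last first.
      by rewrite inE => /eqP E ->; rewrite e'emb E.
    case: (e'P k j y) => [[v ->]|[i [t [a ->]]]]; last by rewrite e'b.
    by rewrite e'emb => /eqP[E]; exists v; rewrite ?inE ?E.
  have binj : injective (fun t => Some ((b j i t).1 + a, (b j i t).2 + k)).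
    by move=> t1 t2 [_ /addIr/inj[_ ->]].
  rewrite e'b -(card_imset _ binj); congr #|pred_of_set _|.
  apply/setP => y; rewrite inE; apply/idP/imsetP => [|[t' _ ->]]; last first.
    by rewrite e'b.
  case: (e'P k j y) => [[v ->]|[i' [t' [a' ->]]]]; first by rewrite e'emb.
  by rewrite e'b => /eqP[-> ->]; exists t'.
(* Two points of one hole, infinity included, are joined by a hole block. *)
- have same k u v : u != v -> exists! c, e' c (emb k u) = e' c (emb k v).
    move=> nuv; have [j [Ej jP]] := euniq u v nuv.
    exists (k, j); split; first by rewrite !e'emb Ej.
    move=> [d j'] E; have [dk|ndk] := eqVneq d k.
      by move: E; rewrite dk !e'emb => -[/jP->].
    case/eqP: nuv; move: E; case: u {Ej jP} => [a|]; case: v => [a'|] //=;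
      rewrite /e' /=;
      (case Ep: (pos j' (k - d)) => [[i t]|];
        last by move/posN/eqP: Ep; rewrite subr_eq0 eq_sym (negPf ndk)) => //.
    by case=> /addIr ->.
  move=> [[a k]|] [[a' k']|] // nxy; last 2 first.
  + exact: (same k (Some a) None).
  + exact: (same k' None (Some a')).
  (* Points with distinct K-coordinates are joined by a translate of a base
     block. *)
  have [kk'|nkk'] := eqVneq k k'.
    rewrite -kk' in nxy *; apply: (same k (Some a) (Some a')).
    by apply: contraNneq nxy => -[->].
  have dn0 : k - k' != 0 by rewrite subr_eq0.
  have [j [i [t [s E]]]] := dcover (a - a', k - k') dn0.
  have nts : t != s.
    by apply: contraNneq dn0 => ts; move: E; rewrite ts subrr => -[_ <-].
  have [E1 E2] : (b j i t).1 - (b j i s).1 = a - a' /\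
                 (b j i t).2 - (b j i s).2 = k - k'.
    by move: E; case: (b j i t) (b j i s) => [? ?] [? ?] [].
  (* The shift that moves the elements t and s of the block (j, i) over k and
     k'. *)
  exists (k - (b j i t).2, j); split.
    rewrite /e' /= subKr posE.
    have -> : k' - (k - (b j i t).2) = (b j i s).2.
      by rewrite opprB addrA addrAC -opprB -E2 opprB addrNK.
    by rewrite posE (subr_swap E1).
  move=> [d j']; rewrite /e' /=.
  case Ep: (pos j' (k - d)) => [[i1 t1]|]; case Ep': (pos j' (k' - d)) => [[i2 t2]|] //.
    case=> ii E3; subst i2.
    have [E4 E5] := (posS _ _ _ _ Ep, posS _ _ _ _ Ep').
    have [] := dinj j i t s j' i1 t1 t2 nts; last first.
      by move=> jj ii tt' ss'; subst; rewrite E4 subKr.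
    rewrite E; case: (b j' i1 t1) (b j' i1 t2) E3 E4 E5 => [x1 y1] [x2 y2] /= E3 -> ->.
    congr (_, _).
      by rewrite -[RHS]/(x1 - x2) -(subr_swap (esym E3)).
    by rewrite -[RHS]/(k - d - (k' - d)) opprB addrA subrK.
  move=> _; move/posN/eqP: Ep; move/posN/eqP: Ep'.
  by rewrite !subr_eq0 => /eqP<- /eqP kk'; rewrite kk' eqxx in nkk'.
Qed.

(** * Verifying a frame difference family by computation *)

(** The tuples [(j, i, (t, s))] with [j < n], [i < m] and distinct
    [t, s < k]. *)
Definition quadruples (n m k : nat) : seq (nat * nat * (nat * nat)) :=
  [seq (ji, ts) | ji <- [seq (j, i) | j <- iota 0 n, i <- iota 0 m],
     ts <- [seq ts <- [seq (t, s) | t <- iota 0 k, s <- iota 0 k] | ts.1 != ts.2]].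

Lemma mem_quadruples n m k j i t s :
  (j < n)%N -> (i < m)%N -> (t < k)%N -> (s < k)%N -> t != s ->
  (j, i, (t, s)) \in quadruples n m k.
Proof.
move=> jn im tk sk nts; apply: allpairs_f.
  by apply: allpairs_f; rewrite mem_iota.
by rewrite mem_filter nts allpairs_f // mem_iota.
Qed.

Lemma uniq_map_inj_in (S T : eqType) (f : S -> T) (r : seq S) :
  uniq [seq f x | x <- r] -> {in r &, injective f}.
Proof.
elim: r => // z r IH /= /andP[fz ur] x y.
rewrite !inE => /predU1P[->|xr] /predU1P[->|yr] // E; last exact: IH.
  by rewrite E map_f in fz.
by rewrite -E map_f in fz.
Qed.

(** Since the base blocks have the right number of elements and of differences,
    distinctness implies covering. *)
Lemma frame_df_check (A K : finZmodType) n m k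
    (b : nat -> nat -> nat -> A * K) :
  #|K| = (m * k).+1 -> (n * m * (k * k.-1) = #|A| * (m * k))%N ->
  all (fun j => uniq (0 :: [seq (b j i t).2 | i <- iota 0 m, t <- iota 0 k]))
    (iota 0 n) ->
  uniq [seq b q.1.1 q.1.2 q.2.1 - b q.1.1 q.1.2 q.2.2 | q <- quadruples n m k] ->
  frame_df (fun (j : 'I_n) (i : 'I_m) (t : 'I_k) => b j i t).
Proof.
move=> cK cA /allP uj udiff.
pose f j (it : 'I_m * 'I_k) := (b j it.1 it.2).2.
have mem_it (i : 'I_m) (t : 'I_k) j :
    f j (i, t) \in [seq (b j i t).2 | i <- iota 0 m, t <- iota 0 k].
  by apply: (allpairs_f (fun i t => (b j i t).2)); rewrite mem_iota ltn_ord.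
have nz (j : 'I_n) i t : f j (i, t) != 0.
  have /uj /=/andP[n0 _] : (j : nat) \in iota 0 n by rewrite mem_iota ltn_ord.
  by apply: contraNneq n0 => <-; exact: mem_it.
have f_inj (j : 'I_n) : injective (f j).
  move=> [i t] [i' t'] E.
  have /uj /=/andP[_ u] : (j : nat) \in iota 0 n by rewrite mem_iota ltn_ord.
  rewrite -(map_allpairs (fun it => (b j it.1 it.2).2) pair) in u.
  have mem_p (i0 : 'I_m) (t0 : 'I_k) : (val i0, val t0) \in
      [seq (i1, t1) | i1 <- iota 0 m, t1 <- iota 0 k].
    by apply: allpairs_f; rewrite mem_iota ltn_ord.
  by case: (uniq_map_inj_in u (mem_p i t) (mem_p i' t') E) => /val_inj-> /val_inj->.
pose g (q : 'I_n * 'I_m * ('I_k * 'I_k)) :=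
  b q.1.1 q.1.2 q.2.1 - b q.1.1 q.1.2 q.2.2.
pose X := [set q : 'I_n * 'I_m * ('I_k * 'I_k) | q.2.1 != q.2.2].
have g_inj : {in X &, injective g}.
  move=> [[j i] [t s]] [[j' i'] [t' s']]; rewrite !inE /= => nts nts' E.
  have [] := uniq_map_inj_in udiff
    (mem_quadruples (ltn_ord j) (ltn_ord i) (ltn_ord t) (ltn_ord s) nts)
    (mem_quadruples (ltn_ord j') (ltn_ord i') (ltn_ord t') (ltn_ord s') nts') E.
  by move=> /val_inj-> /val_inj-> /val_inj-> /val_inj->.
have cX : #|X| = (n * m * (k * k.-1))%N.
  have -> : X = setX setT (~: [set (t, t) | t : 'I_k]).
    apply/setP => -[ji [t s]]; rewrite !inE /=; congr (~~ _).
    by apply/eqP/imsetP => [->|[t' _ [-> ->]]] //; exists s.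
  rewrite cardsX cardsT !card_prod !card_ord cardsCs setCK card_prod !card_ord.
  rewrite card_imset ?card_ord; last by move=> ? ? [].
  by congr (_ * _)%N; rewrite -subn1 mulnBr muln1.
have gX : g @: X = setX setT [set~ 0].
  apply/eqP; rewrite eqEcard; apply/andP; split.
    apply/subsetP => _ /imsetP[[[j i] [t s]] /[!inE] /= nts ->].
    apply: contraNneq nts => /eqP; rewrite subr_eq0 => /eqP.
    by move/(f_inj j (i, t) (i, s)) => [->].
  by rewrite card_in_imset // cX cardsX cardsT cardsC1 cK cA.
split.
- by move=> j i t; exact: nz.
- move=> j d dn0; have : d \in [set f j it | it in setT].
    suff -> : [set f j it | it in setT] = [set~ 0] by rewrite !inE.
    apply/eqP; rewrite eqEcard cardsC1 cK card_imset // cardsT card_prod !card_ord.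
    rewrite leqnn andbT; apply/subsetP => _ /imsetP[[i t] _ ->].
    by rewrite !inE nz.
  by case/imsetP=> [[i t] _ ->]; exists i, t.
- by move=> j i t i' t' /(f_inj j (i, t) (i', t')) [-> ->].
- move=> d dn0; have : d \in g @: X by rewrite gX !inE.
  by case/imsetP=> [[[j i] [t s]] _ ->]; exists j, i, t, s.
move=> j i t s j' i' t' s' nts E.
have nts' : t' != s'.
  apply: contraNneq nts => ts'; move: E; rewrite ts' subrr => /(congr1 snd) /= /eqP.
  by rewrite subr_eq0 => /eqP /(f_inj j (i, t) (i, s)) [->].
have qX : (j, i, (t, s)) \in X by rewrite inE.
have q'X : (j', i', (t', s')) \in X by rewrite inE.
by case: (g_inj _ _ qX q'X E) => -> -> -> ->.
Qed.

(** * The two explicit families *)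

(** The line [g + F_8] of the affine plane over the field of order 8, inside the
    field of order 64 generated by [g] with [g^6 = g + 1]; its points are
    written as the residues modulo 7 and 9 of their logarithms to the base
    [g]. *)
Definition affine_block : seq ('Z_7 * 'Z_9) :=
  [:: (1, 1); (6%:R, 6%:R); (0, 4%:R); (6%:R, 3%:R);
      (1, 8%:R); (0, 5%:R); (3%:R, 2%:R); (3%:R, 7%:R)].

Lemma affine_frame_df :
  frame_df (fun (_ _ : 'I_1) (t : 'I_8) => nth 0 affine_block t).
Proof.
apply: (@frame_df_check 'Z_7 'Z_9 1 1 8 (fun _ _ t => nth 0 affine_block t)).
- by rewrite card_ord.
- by rewrite card_ord.
- by vm_compute.
- by vm_compute.
Qed.

(** The hole and the quotient group of the second family.  The pair [(x, y)] of
    [Z_5^2] is thought of as the element [x + y * omega] of the field of order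
    25, where [omega] is a primitive element with
    [omega^2 + omega + 2 = 0]. *)
Definition frame_hole : finZmodType := ('Z_7 * ('Z_3 * 'Z_3))%type.
Definition frame_quot : finZmodType := ('Z_5 * 'Z_5)%type.

(** Multiplication by the cube root of unity [omega^8 = 1 + 3 * omega] on the
    field of order 25. *)
Definition mult_w (g : frame_hole * frame_quot) : frame_hole * frame_quot :=
  let: (a, (x, y)) := g in (a, (x - y, (x + y) *+ 3)).

(** The map [e |-> omega * e^5] on the field of order 25, combined with a
    rotation of order 4 of [Z_3^2].  It normalizes the group generated by
    [mult_w]; together they generate a group of order 24, which is regular on
    the nonzero elements of the field (they are the multiplications of a
    nearfield). *)
Definition mult_h (g : frame_hole * frame_quot) : frame_hole * frame_quot :=
  let: ((z, (u, v)), (x, y)) := g in ((z, (v, - u)), (y *+ 2, x)).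

(** The initial block of the families 0 to 7.  Its [Z_5^2]-coordinates lie in
    the eight distinct orbits of [mult_w]; its 56 differences, together with the 7
    differences between [((0, (1, 0)), (1, 0))] and the other points of its
    orbit under [mult_h], represent once each of the 63 orbits of the group of
    order 24 outside the hole. *)
Definition generic_block : seq (frame_hole * frame_quot) :=
  [:: ((0, (0, 0)), (1, 0));
      ((0, (-1, 0)), (1, -1));
      ((1, (0, 1)), (0, 1));
      ((2%:R, (0, 0)), (2%:R, 3%:R));
      ((3%:R, (0, 0)), (0, 2%:R));
      ((4%:R, (0, -1)), (0, 3%:R));
      ((5%:R, (1, 1)), (1, 2%:R));
      ((6%:R, (-1, -1)), (-1, 1))].

(** The family [j < 8] consists of the images of [mult_h^j generic_block] under
    the powers of [mult_w]; the last family, [j = 8], of the images of an orbit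
    of length 8 of [mult_h]. *)
Definition frame_block (j i t : nat) : frame_hole * frame_quot :=
  iter i mult_w
    (if (j < 8)%N then iter j mult_h (nth 0 generic_block t)
     else iter t mult_h ((0, (1, 0)), (1, 0))).

Lemma frame_block_frame_df :
  frame_df (fun (j : 'I_9) (i : 'I_3) (t : 'I_8) => frame_block j i t).
Proof.
apply: (@frame_df_check frame_hole frame_quot 9 3 8 frame_block).
- by rewrite card_prod !card_ord.
- by rewrite !card_prod !card_ord.
- by vm_compute.
- by vm_compute.
Qed.

Theorem theorem2p11 :
  exists (V : finType) (A : seq {set V}), is_rbibd 14176 8 1 A.
Proof.
(* The field of order 9, used for both inflations, and 8 distinct elements. *)
have [F _ cF] := PrimePowerField (isT : prime 3) (isT : (0 < 2)%N).
have le8F : (#|'I_8| <= #|F|)%N by rewrite cF card_ord.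
pose y (t : 'I_8) : F := enum_val (widen_ord le8F (enum_rank t)).
have y_inj : injective y.
  by move=> s t /enum_val_inj/(congr1 val)/= /val_inj/enum_rank_inj.
have rd8 : resolvable_design 8 (option 'Z_7) 'I_1.
  have := resolvable_design_trivial (option 'Z_7).
  rewrite card_option card_ord.
  by apply: resolvable_design_card; rewrite // card_ord card_unit.
have fill := @frame_df_fill _ _ _ _ 'I_8; rewrite card_ord in fill.
have rd64 := fill _ _ _ _ _ affine_frame_df rd8.
have rd568 : resolvable_design 8 (option ('Z_7 * F * 'Z_9)) ('Z_9 * ('I_1 * F))%type.
  apply: fill (frame_df_inflate y_inj affine_frame_df) _.
  apply: resolvable_design_card rd64.
    by rewrite !card_option !card_prod cF !card_ord.
  by rewrite !card_prod cF !card_ord.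
have rd14176 : resolvable_design 8 (option (frame_hole * F * frame_quot))
    (frame_quot * ('I_9 * F))%type.
  apply: fill (frame_df_inflate y_inj frame_block_frame_df) _.
  apply: resolvable_design_card rd568.
    by rewrite !card_option !card_prod cF !card_ord.
  by rewrite !card_prod cF !card_ord.
have [A AP] := resolvable_design_rbibd rd14176.
exists _, A.
suff <- : #|((option (frame_hole * F * frame_quot))%type : finType)| = 14176%N.
  by [].
rewrite card_option !card_prod cF !card_ord.
by vm_compute.
Qed.
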